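(* Let $\alpha=\alpha_0^{p^s}\in\mathcal{T}_2\setminus\{0\}$, where $\alpha_0\in\mathcal{T}_2$ is such that $x^n-\alpha_0$ is irreducible over $\mathcal{R}_2$. When $\beta\in\mathcal{T}_2\setminus\{0\}$, $\langle(x^n-\alpha_0)^{p^s}\rangle=\langle\gamma\rangle$ is the only isodual $(\alpha+\gamma\beta)$-constacyclic code of length $np^s$ over $\mathcal{R}_2$.
   Context: $\mathcal{R}_2$ is a finite commutative chain ring with unity, with maximal ideal $\langle\gamma\rangle$, where $\gamma\neq0$ and $\gamma^2=0$; its residue field has order $p^m$, $p$ prime. $\zeta\in\mathcal{R}_2$ has multiplicative order $p^m-1$ and $\mathcal{T}_2=\{0,1,\zeta,\dots,\zeta^{p^m-2}\}$. $n,s$ are positive integers with $\gcd(n,p)=1$. For a unit $\lambda$, a $\lambda$-constacyclic code of length $N$ over $\mathcal{R}_2$ is a submodule of $\mathcal{R}_2^N$ closed under $(a_0,\dots,a_{N-1})\mapsto(\lambda a_{N-1},a_0,\dots,a_{N-2})$, identified via $(a_i)\mapsto\sum a_ix^i$ with an ideal of $\mathcal{R}_2[x]/\langle x^N-\lambda\rangle$. The dual code of $\mathcal{C}$ is $\mathcal{C}^\perp=\{u\in\mathcal{R}_2^N:\sum u_ic_i=0\ \forall c\in\mathcal{C}\}$, a $\lambda^{-1}$-constacyclic code. $\mathcal{C}$ is isodual if it is $\mathcal{R}_2$-linearly equivalent to $\mathcal{C}^\perp$, i.e. $\mathcal{C}^\perp$ is the image of $\mathcal{C}$ under a monomial transformation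 of $\mathcal{R}_2^N$ (a permutation of coordinates combined with multiplication of each coordinate by a unit of $\mathcal{R}_2$). *)

(* Defs.v *)
From HB Require Import structures.
From mathcomp Require Import all_boot all_order all_fingroup all_algebra.

Set Implicit Arguments.
Unset Strict Implicit.
Unset Printing Implicit Defensive.

Import GRing.Theory.
Local Open Scope ring_scope.

Section Ideals.
Variable A : finComNzRingType.

Definition is_ideal (I : {set A}) : Prop :=
  0 \in I /\ forall a x y : A, x \in I -> y \in I -> a * x + y \in I.

Definition principal (g : A) : {set A} := [set a * g | a : A].

Definition is_maximal_ideal (I : {set A}) : Prop :=
  [/\ is_ideal I, I != setT &
      forall J : {set A}, is_ideal J -> I \subset J -> J = I \/ J = setT].

Definition is_chain_ring : Prop :=
  forall I J : {set A}, is_ideal I -> is_ideal J -> I \subset J \/ J \subset I.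

(* The underlying set of the residue ring A / I. *)
Definition cosets (I : {set A}) : {set {set A}} :=
  [set [set x + y | y in I] | x : A].

End Ideals.

(* Irreducible elements of an arbitrary commutative ring: MathComp's
   irreducible_poly is restricted to coefficients in an integral domain, and
   MathComp has no unit ring structure on {poly R} when R has zero divisors. *)
Section Irreducible.
Variable A : comNzRingType.

Definition invertible (a : A) : Prop := exists b : A, a * b = 1.

Definition irreducible_elt (a : A) : Prop :=
  [/\ a != 0, ~ invertible a &
      forall b c : A, a = b * c -> invertible b \/ invertible c].

End Irreducible.

Section Codes.
Variables (R : finComUnitRingType) (N : nat).
Implicit Types (lam : R) (C D : {set 'rV[R]_N}).

(* {0, 1, zeta, ..., zeta^(k - 1)} *)
Definition teichmuller (zeta : R) (k : nat) : {set R} :=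
  0 |: [set zeta ^+ i | i : 'I_k].

(* (a_0, ..., a_(N-1)) |-> (lam a_(N-1), a_0, ..., a_(N-2));
   ord_pred is the cyclic predecessor on 'I_N. *)
Definition constashift lam (a : 'rV[R]_N) : 'rV[R]_N :=
  \row_(i < N) (if (i == 0 :> nat)%N then lam * a 0 (ord_pred i)
                else a 0 (ord_pred i)).

Definition constacyclic lam C : Prop :=
  GRing.submod_closed C /\ forall c, c \in C -> constashift lam c \in C.

Definition dual C : {set 'rV[R]_N} :=
  [set u : 'rV[R]_N | [forall c in C, \sum_(i < N) u 0 i * c 0 i == 0]].

Definition monomial_equiv C D : Prop :=
  exists (sigma : 'S_N) (d : 'I_N -> R),
    (forall i, d i \is a GRing.unit) /\
    D = [set \row_(i < N) (d i * c 0 (sigma i)) | c : 'rV[R]_N in C].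

Definition isodual C : Prop := monomial_equiv C (dual C).

(* R[x] / <x^N - lam>.  The modulus is monic, and it is nonconstant as soon as
   0 < N, so that {poly %/ _} is then the intended quotient. *)
Definition ambient lam := {poly %/ ('X^N - lam%:P)}.
HB.instance Definition _ lam := GRing.ComNzRing.on (ambient lam).
HB.instance Definition _ lam := Finite.on (ambient lam).

Definition to_ambient lam (f : {poly R}) : ambient lam :=
  in_qpoly ('X^N - lam%:P) f.

(* The code identified with a subset I of R[x] / <x^N - lam> under
   (a_i) |-> \sum_i a_i x^i. *)
Definition code_of lam (I : {set ambient lam}) : {set 'rV[R]_N} :=
  [set a : 'rV[R]_N | to_ambient lam (\sum_(i < N) (a 0 i)%:P * 'X^i) \in I].

End Codes.

(* Main.v *)
Require Import Defs.
From HB Require Import structures.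
From mathcomp Require Import all_boot all_order all_fingroup all_algebra.
From mathcomp Require Import all_field ring.

Import GRing.Theory.
Local Open Scope ring_scope.

(** Put f = x^n - alpha0, N = n p^s, lam = alpha + gamma beta,
    A = R[x]/(x^N - lam), and let F, G be the classes of f and gamma in A.

    The two generators.  Over the residue field K, of characteristic p, one has
    f^(p^s) = x^N - alpha.  Over R the difference of the two sides is both a
    multiple of f and a multiple of gamma, hence of gamma f since f is monic
    ([pow_binomial]).  In A, where x^N - alpha = gamma beta, this reads
    F^(p^s) = G (beta + F H).  As gamma^2 = 0, F is nilpotent, so beta + F H is
    a unit and F^(p^s), G generate the same ideal
    ([binomial_class_pow_assoc]).

    A is local with maximal ideal (F).  The polynomial f stays irreducible over
    K: it is separable there, so a factorization over K has coprime factors and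
    lifts to R by one Hensel step, which is exact since gamma^2 = 0
    ([irreducible_reduction]).  Hence A/(F) = K[x]/(f) is a field, and every
    element of A outside (F) is invertible ([ambient_local]).  Consequently
    every ideal of A is comparable with every power of (F)
    ([ideal_comparable]).

    Duality.  The ideal (G) corresponds to the words with all entries in
    gamma R.  This code is its own dual since gamma R is its own annihilator
    ([dual_code_of_constant]); in particular it is isodual.  Conversely let C be
    isodual and constacyclic, so that C is comparable with D = (G) = dual D, and
    dual C has as many words as C.  If C is inside D then D = dual D is inside
    dual C, so D has no more words than C and C = D; the case where D is inside
    C is symmetric ([isodual_comparable_self_dual]). *)

(** * Principal ideals *)

Lemma principalP (A : finComNzRingType) (g x : A) :
  reflect (exists a, x = a * g) (x \in principal g).
Proof.
apply: (iffP imsetP) => [[a _ ->]|[a ->]]; first by exists a.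
by exists a.
Qed.

Lemma principal_is_ideal (A : finComNzRingType) (g : A) :
  is_ideal (principal g).
Proof.
split=> [|a x y /principalP[b ->] /principalP[c ->]].
  by apply/principalP; exists 0; rewrite mul0r.
by apply/principalP; exists (a * b + c); rewrite mulrDl mulrA.
Qed.

Lemma ideal_sub_principal (A : finComNzRingType) (J : {set A}) (g : A) :
  is_ideal J -> g \in J -> principal g \subset J.
Proof.
move=> [J0 Jl] Jg; apply/subsetP=> _ /principalP[a ->].
by rewrite -[a * g]addr0 Jl.
Qed.

Lemma principal_assoc (A : finComNzRingType) (g w : A) :
  invertible w -> principal (g * w) = principal g.
Proof.
move=> [v wv1]; apply/eqP; rewrite eqEsubset !ideal_sub_principal //;
  try exact: principal_is_ideal; apply/principalP.
  by exists v; rewrite mulrCA (mulrC v) wv1 mulr1.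
by exists w; rewrite mulrC.
Qed.

(** * The residue field *)

Section ResidueField.
Context {R : finComUnitRingType} {gamma : R}.
Hypothesis maxg : is_maximal_ideal (principal gamma).
Hypothesis g2_eq0 : gamma ^+ 2 = 0.

(** A maximal ideal with a nilpotent generator is the only maximal ideal. *)
Lemma maximal_unit x : x \notin principal gamma -> x \is a GRing.unit.
Proof.
(* by maximality, 1 lies in the ideal J generated by x and gamma *)
have [_ _ maxJ] := maxg => nIx.
pose J := [set a * x + b * gamma | a : R, b : R].
have idJ : is_ideal J.
  split=> [|a _ _ /imset2P[b c _ _ ->] /imset2P[d e _ _ ->]].
    by apply/imset2P; exists 0 0; rewrite // !mul0r addr0.
  apply/imset2P; exists (a * b + d) (a * c + e) => //.
  by rewrite mulrDr !mulrDl !mulrA addrACA.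
have sIJ : principal gamma \subset J.
  apply: ideal_sub_principal => //.
  by apply/imset2P; exists 0 1; rewrite // mul0r mul1r add0r.
have Jx : x \in J.
  by apply/imset2P; exists 1 0; rewrite // mul0r mul1r addr0.
have [eqJ|eqJ] := maxJ J idJ sIJ; first by rewrite eqJ (negPf nIx) in Jx.
have : (1 : R) \in J by rewrite eqJ inE.
case/imset2P=> a b _ _ def1; apply/unitrPr; exists (a * (1 + b * gamma)).
(* with z = b gamma, a x = 1 - z and (1 - z) (1 + z) = 1 - z^2 = 1 *)
have -> : x * (a * (1 + b * gamma)) = a * x * (1 + b * gamma).
  by rewrite mulrA (mulrC x).
have -> : a * x = 1 - b * gamma by rewrite def1 addrK.
by rewrite -subr_sqr expr1n exprMn g2_eq0 mulr0 subr0.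
Qed.

Lemma annihilator_maximal x :
  gamma != 0 -> (gamma * x == 0) = (x \in principal gamma).
Proof.
move=> g_neq0; apply/idP/principalP => [/eqP gx0|[a ->]]; last first.
  by rewrite mulrCA -expr2 g2_eq0 mulr0.
apply/principalP; apply: contraNT g_neq0 => /maximal_unit Ux.
by rewrite -(mulrK Ux gamma) gx0 mul0r.
Qed.

(** The quotient by the maximal ideal is kept behind an existential: only
    surjectivity and the kernel of the reduction matter afterwards. *)
Lemma exists_residue_field : exists (K : fieldType) (pi : {rmorphism R -> K}),
  (forall y, exists x, pi x = y) /\
  forall x, (pi x == 0) = (x \in principal gamma).
Proof.
have [Iid] := maxg; rewrite -subTset => nIT _.
have [I0 Il] := Iid.
have idI : idealr_closed (mem (principal gamma)).
  split=> //; apply: contra nIT => I1; apply/subsetP=> x _.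
  by rewrite -[x]mulr1 -[x * 1]addr0 Il.
pose Ib : R -> bool := mem (principal gamma).
pose I : idealr R := HB.pack Ib (isIdealr.Build R Ib idI).
pose Q : comNzRingType := {ideal_quot I}.
pose pi : {rmorphism R -> Q} := \pi_{ideal_quot I}%qT.
pose rep (y : Q) : R := generic_quotient.repr (y : {ideal_quot I}).
have repK y : pi (rep y) = y by exact: (reprK (y : {ideal_quot I})).
have pi_surj y : exists x, pi x = y by exists (rep y).
have pi_eq0 x : (pi x == 0) = (x \in principal gamma).
  by rewrite -(rmorph0 pi) -(Quotient.idealrBE I) subr0.
pose inv (y : Q) : Q := if y == 0 then 0 else pi (rep y)^-1.
have invP y : y != 0 -> inv y * y = 1.
  move=> nz_y; rewrite /inv (negPf nz_y) -{2}[y]repK -rmorphM mulVr ?rmorph1 //.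
  apply: maximal_unit; rewrite -pi_eq0; apply: contra nz_y.
  by rewrite -{2}[y]repK.
have inv0 : inv 0 = 0 by rewrite /inv eqxx.
pose K : fieldType := HB.pack Q (GRing.ComNzRing_isField.Build Q invP inv0).
pose piK : {rmorphism R -> K} := HB.pack (pi : R -> K) (GRing.RMorphism.on pi).
by exists K, piK.
Qed.

End ResidueField.

(** * Reduction of polynomials modulo gamma *)

Section Reduction.
Context {R : finComUnitRingType} {gamma : R}.
Context {K : fieldType} (pi : {rmorphism R -> K}).
Hypothesis pi_surj : forall y, exists x, pi x = y.
Hypothesis pi_eq0 : forall x, (pi x == 0) = (x \in principal gamma).
Local Notation "P ^pi" := (map_poly pi P) (at level 2, format "P ^pi").

(** The residue field has as many elements as there are cosets.  Translation by
    1 permutes them, so their sum does not change when 1 is added to each. *)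
Lemma card_residue_eq0 : #|cosets (principal gamma)|%:R = 0 :> K.
Proof.
(* the cosets are the fibres of pi *)
pose fib k := [set x | pi x == k].
have cosetE x : [set x + y | y in principal gamma] = fib (pi x).
  apply/setP=> z; rewrite inE; apply/imsetP/eqP=> [[y Iy ->]|eq_zx].
    by rewrite rmorphD; move: Iy; rewrite -pi_eq0 => /eqP->; rewrite addr0.
  exists (z - x); last by rewrite addrC subrK.
  by rewrite -pi_eq0 rmorphB eq_zx subrr.
pose s := undup [seq pi x | x : R].
have mem_s k : k \in s.
  have [x <-] := pi_surj k; rewrite mem_undup; apply/mapP; exists x => //.
  by rewrite mem_enum.
have -> : #|cosets (principal gamma)| = size s.
  rewrite cardE -(size_map fib s); apply/perm_size/uniq_perm.
  - exact: enum_uniq.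
  - rewrite map_inj_uniq ?undup_uniq // => k l /setP eq_kl.
    have [x def_k] := pi_surj k.
    by have := eq_kl x; rewrite !inE def_k eqxx => /esym/eqP.
  move=> c; rewrite mem_enum; apply/imsetP/mapP=> [[x _ ->]|[k _ ->]].
    by exists (pi x).
  by have [x <-] := pi_surj k; exists x.
have : \sum_(k <- [seq k + 1 | k <- s]) k = \sum_(k <- s) k.
  apply/perm_big/uniq_perm; rewrite ?undup_uniq ?map_inj_uniq ?undup_uniq //.
    exact: addIr.
  move=> k; rewrite mem_s; apply/mapP; exists (k - 1) => //.
  by rewrite subrK.
rewrite big_map big_split /= => /eqP; rewrite -subr_eq0 addrAC subrr add0r.
by rewrite big_const_seq count_predT iter_addr_0 => /eqP.
Qed.

Lemma map_poly_surj (P : {poly K}) : exists Q, Q^pi = P.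
Proof.
elim/poly_ind: P => [|P c [Q <-]]; first by exists 0; rewrite rmorph0.
have [d <-] := pi_surj c; exists (Q * 'X + d%:P).
by rewrite rmorphD rmorphM /= map_polyX map_polyC.
Qed.

Lemma map_poly_ker {P} : P^pi = 0 -> exists Q, P = gamma%:P * Q.
Proof.
elim/poly_ind: P => [|P c IH]; first by exists 0; rewrite mulr0.
rewrite rmorphD rmorphM /= map_polyX map_polyC => eq0.
have := congr1 (coefp 0) eq0; rewrite /= coefD coefMX coefC /= coef0 add0r.
move=> pic0; move: eq0; have -> : (pi c)%:P = 0 by rewrite -polyC0; congr _%:P.
rewrite addr0 => /eqP; move/eqP: pic0.
rewrite mulf_eq0 polyX_eq0 orbF pi_eq0 => /principalP[d ->] /eqP/IH[Q ->].
exists (Q * 'X + d%:P).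
by rewrite mulrDr mulrA polyCM (mulrC d%:P).
Qed.

Lemma size_map_invertible P : invertible P -> size P^pi = 1%N.
Proof.
case=> Q /(congr1 (map_poly pi)); rewrite rmorphM rmorph1 /= => eq1.
by have /andP[/eqP-> _] : (size P^pi == 1%N) && (size Q^pi == 1%N);
  rewrite -?size_mul_eq1 ?eq1 ?size_poly1.
Qed.

(** Hensel lifting.  If f reduces to e q with u e + v q = 1 over K, lift these
    to E, Q, U, V and write f = E Q + gamma k.  Then
    (E + gamma k V) (Q + gamma k U) = E Q + gamma k (V Q + U E) = f, because
    gamma^2 = 0, so one of these two factors is invertible in R[x]; its
    reduction, e or q, is then a nonzero constant. *)
Lemma irreducible_reduction f :
    gamma ^+ 2 = 0 -> f \is monic -> separable_poly f^pi ->
  irreducible_elt f -> irreducible_poly f^pi.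
Proof.
move=> g2_eq0 f_monic f_sep [f_neq0 f_ninv f_irr]; split=> [|q q_neq1].
  rewrite ltnNge size_map_poly_id0 ?(monicP f_monic) ?rmorph1 ?oner_eq0 //.
  apply/negP => size_f; case: f_ninv.
  exists 1; rewrite mulr1; move: f_monic.
  by rewrite (size1_polyC size_f) monicE lead_coefC => /eqP->.
case/dvdpP=> e def_f; move: f_sep.
rewrite def_f separable_mul => /and3P[_ _ /Bezout_eq1_coprimepP[[u v] /= eq1]].
have [[E defE] [Q defQ]] := (map_poly_surj e, map_poly_surj q).
have [[U defU] [V defV]] := (map_poly_surj u, map_poly_surj v).
have [|k def_k] := map_poly_ker (P := f - E * Q).
  by rewrite rmorphB rmorphM /= defE defQ def_f subrr.
have [|w def_w] := map_poly_ker (P := U * E + V * Q - 1).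
  by rewrite rmorphB rmorphD !rmorphM rmorph1 /= defE defQ defU defV eq1 subrr.
have gg0 : gamma%:P * gamma%:P = 0 :> {poly R} by rewrite -polyCM -expr2 g2_eq0.
pose E1 := E + gamma%:P * (k * V); pose Q1 := Q + gamma%:P * (k * U).
have red_add P T : (P + gamma%:P * T)^pi = P^pi.
  rewrite rmorphD rmorphM /= map_polyC /=; suff /eqP-> : pi gamma == 0.
    by rewrite mul0r addr0.
  by rewrite pi_eq0; apply/principalP; exists 1; rewrite mul1r.
have lift_f : f = E1 * Q1.
  have -> : E1 * Q1 = E * Q + gamma%:P * k * (U * E + V * Q)
                      + gamma%:P * gamma%:P * (k * k * U * V).
    by rewrite /E1 /Q1; ring.
  rewrite gg0 mul0r addr0 -[U * E + _](subrK 1) def_w mulrDr mulr1.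
  by rewrite mulrACA gg0 mul0r add0r -def_k addrC subrK.
have [/size_map_invertible|/size_map_invertible] := f_irr _ _ lift_f.
  rewrite red_add defE => /eqP/size_poly1P[c c_neq0 ->].
  by rewrite mul_polyC eqp_sym eqp_scale.
by rewrite red_add defQ => size_q; rewrite size_q eqxx in q_neq1.
Qed.

(** The difference of f^(p^s) and x^(n p^s) - a^(p^s) is f h for some h because
    x^n - a divides x^(nq) - a^q; it vanishes over K by Frobenius, and since f
    reduces to a nonzero polynomial so does h. *)
Lemma pow_binomial (a : R) (p s n : nat) :
    p \in [pchar K] -> (0 < n)%N ->
  exists H, ('X^n - a%:P) ^+ (p ^ s) =
    'X^(n * p ^ s) - (a ^+ (p ^ s))%:P + gamma%:P * (('X^n - a%:P) * H).
Proof.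
move=> charKp n_gt0; set f := 'X^n - a%:P; set q := (p ^ s)%N.
have [p_pr _] := andP charKp.
have q_gt0 : (0 < q)%N by rewrite expn_gt0 prime_gt0.
have f_monic : f \is monic by apply: monicXnsubC.
have [h def_h] : exists h, f ^+ q - ('X^(n * q) - (a ^+ q)%:P) = f * h.
  rewrite exprM polyC_exp subrXX -/f -(prednK q_gt0) exprS -mulrBr.
  by eexists.
have [|H def_H] := map_poly_ker (P := h); last first.
  by exists H; rewrite mulrCA -def_H -def_h addrC subrK.
have f_neq0 : f^pi != 0 by rewrite monic_neq0 // monic_map.
(* in characteristic p, (x - y)^q + y^q = x^q *)
have frob (x y : {poly K}) : (x - y) ^+ q = x ^+ q - y ^+ q.
  have q_pchar : [pchar {poly K}].-nat q.
    by rewrite (eq_pnat q (pchar_poly _)) (eq_pnat q (pcharf_eq charKp))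
      pnatX pnat_id.
  by have := exprDn_pchar (x - y) y q_pchar; rewrite subrK => ->; rewrite addrK.
apply/(mulfI f_neq0); rewrite mulr0 -rmorphM -def_h.
rewrite !rmorphB rmorphXn rmorphB /=.
by rewrite !map_polyXn !map_polyC /= -/q frob rmorphXn polyC_exp -exprM subrr.
Qed.
End Reduction.

(** * Local rings with a principal maximal ideal *)

Lemma invertible_1B_nilpotent (A : comNzRingType) (z : A) k :
  z ^+ k = 0 -> invertible (1 - z).
Proof.
move=> zk0; exists (\sum_(i < k) z ^+ i).
by rewrite -opprB mulNr -subrX1 zk0 sub0r opprK.
Qed.

Lemma invertibleD_nilpotent (A : comNzRingType) (u z : A) k :
  invertible u -> z ^+ k = 0 -> invertible (u + z).
Proof.
move=> [v uv1] zk0.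
have [|w] := @invertible_1B_nilpotent A (- (z * v)) k.
  by rewrite exprNn exprMn zk0 mul0r mulr0.
by rewrite opprK => def1; exists (v * w); rewrite mulrA mulrDl uv1.
Qed.

(** The hypothesis says that (F) contains all non-units, i.e. that A is local
    with principal maximal ideal (F), or that F is a unit. *)
Section LocalPrincipal.
Context {A : finComNzRingType} {F : A}.
Hypothesis F_local : forall b, (exists c, b = c * F) \/ invertible b.

(** Dividing by F as often as possible, at most i times, leaves either F^i or an
    invertible cofactor. *)
Lemma local_dichotomy i b :
  (exists c, b = c * F ^+ i) \/
  exists j u, [/\ (j < i)%N, invertible u & b = u * F ^+ j].
Proof.
elim: i => [|i [[c ->]|[j [u [lt_ji Uu ->]]]]].
- by left; exists b; rewrite mulr1.
- have [[d ->]|Uc] := F_local c; last by right; exists i, c.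
  by left; exists d; rewrite -mulrA -exprS.
by right; exists j, u; split=> //; apply: leqW.
Qed.

(** An element of J outside (F^i) is u F^j with u invertible and j < i, so F^j,
    and with it F^i, lies in J. *)
Lemma ideal_comparable i (J : {set A}) : is_ideal J ->
  J \subset principal (F ^+ i) \/ principal (F ^+ i) \subset J.
Proof.
move=> idJ.
have [sJF|/subsetPn[b Jb nFb]] := boolP (J \subset principal (F ^+ i)).
  by left.
right; apply: ideal_sub_principal => //.
have [[c def_b]|[j [u [lt_ji [v uv1] def_b]]]] := local_dichotomy i b.
  by case/principalP: nFb; exists c.
suff -> : F ^+ i = F ^+ (i - j) * v * b + 0 by apply: (idJ.2 _ _ _ Jb idJ.1).
rewrite addr0 def_b mulrA -(mulrA _ v) (mulrC v) uv1 mulr1 -exprD subnK //.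
exact: ltnW.
Qed.

End LocalPrincipal.

(** * Words, classes and codes *)

Section Words.
Context {R : finComUnitRingType} {N : nat} {lam : R}.
Hypothesis N_gt0 : (0 < N)%N.
Local Notation toA := (to_ambient N lam).
Implicit Types (a b : 'rV[R]_N) (J : {set ambient N lam}).
Implicit Types (C D : {set 'rV[R]_N}).

HB.instance Definition _ :=
  GRing.RMorphism.copy toA (in_qpoly ('X^N - lam%:P : {poly R})).

Definition word_poly a : {poly R} := \sum_(i < N) (a 0 i)%:P * 'X^i.

(** This puts the polynomial of a word within the reach of the theory of the
    linear bijection between row vectors and polynomials of bounded size. *)
Lemma word_polyE a : word_poly a = rVpoly a.
Proof.
by rewrite /rVpoly poly_def; apply: eq_bigr => i _; rewrite valK mul_polyC.
Qed.

Lemma size_modulus : size (mk_monic ('X^N - lam%:P : {poly R})) = N.+1.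
Proof.
by rewrite /mk_monic size_XnsubC // ltnS N_gt0 monicXnsubC ?size_XnsubC.
Qed.

Lemma to_ambient_modulus : toA ('X^N - lam%:P) = 0.
Proof.
apply: val_inj; rewrite /= /mk_monic size_XnsubC // ltnS N_gt0 monicXnsubC //=.
by rewrite Pdiv.RingMonic.rmodpp ?monicXnsubC.
Qed.

Definition word_class a : ambient N lam := toA (word_poly a).

Lemma word_class_linear (x : R) a b :
  word_class (x *: a + b) = toA x%:P * word_class a + word_class b.
Proof.
by rewrite /word_class !word_polyE linearP rmorphD /= -mul_polyC rmorphM.
Qed.

Lemma word_class0 : word_class 0 = 0.
Proof. by rewrite /word_class word_polyE linear0 rmorph0. Qed.

Lemma to_ambient_small (P : {poly R}) : (size P <= N)%N -> polyn (toA P) = P.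
Proof. by move=> leN; rewrite in_qpoly_small // size_modulus. Qed.

Lemma word_class_inj : injective word_class.
Proof.
move=> a b /(congr1 (fun x : ambient N lam => polyn x)).
rewrite /word_class !word_polyE !to_ambient_small ?size_poly //.
by move/(congr1 (poly_rV (d := N))); rewrite !rVpolyK.
Qed.

Lemma word_class_surj (x : ambient N lam) : exists a, word_class a = x.
Proof.
have size_x : (size (polyn x) <= N)%N.
  by rewrite -ltnS -size_modulus; apply: size_mk_monic.
exists (poly_rV (polyn x)); apply: val_inj.
by rewrite /word_class word_polyE poly_rV_K //=; apply: to_ambient_small.
Qed.

Lemma word_class_constashift a :
  word_class (constashift lam a) = toA 'X * word_class a.
Proof.
(* X a(X) has the coefficient a_(N-1) in degree N; trading X^N for lam gives
   the polynomial of the shifted word *)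
have mul_a : word_poly (constashift lam a)
    = 'X * word_poly a - (a 0 (ord_pred (Ordinal N_gt0)))%:P * ('X^N - lam%:P).
  rewrite /word_poly; case: N N_gt0 a => // M M_gt0 a.
  have pred0 (i : 'I_M.+1) : i = 0 :> nat -> ord_pred i = ord_max.
    by move=> i0; apply: val_inj; rewrite /= i0 add0n modn_small.
  have predS (i : 'I_M) : ord_pred (lift ord0 i) = widen_ord (leqnSn M) i.
    by apply: val_inj; rewrite /= add0n modnDr modn_small // ltnS ltnW.
  rewrite big_ord_recl big_ord_recr /= pred0 // !mxE eqxx pred0 // expr0 mulr1.
  under eq_bigr => i _ do rewrite mxE predS /= /bump add1n exprSr mulrA.
  rewrite -mulr_suml polyCM exprS.
  by ring.
rewrite /word_class mul_a rmorphB !rmorphM.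
by have := to_ambient_modulus; rewrite /= => ->; rewrite mulr0 subr0.
Qed.

Lemma in_code_of J a : (a \in code_of J) = (word_class a \in J).
Proof. by rewrite inE. Qed.

Lemma code_of_constacyclic J : is_ideal J -> constacyclic lam (code_of J).
Proof.
move=> [J0 Jl]; split=> [|a]; last first.
  by rewrite !in_code_of word_class_constashift -[_ * _]addr0 => /Jl->.
split=> [|x a b]; rewrite !in_code_of ?word_class0 //.
by rewrite word_class_linear; apply: Jl.
Qed.

(** Stability under the shift is stability under multiplication by X; with
    linearity it gives stability under all of R[x] by Horner induction. *)
Lemma constacyclic_code_of {C} :
  constacyclic lam C ->
  exists2 J : {set ambient N lam}, is_ideal J & C = code_of J.
Proof.
case=> [[C0 Cl] Cshift]; exists [set word_class a | a in C]; last first.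
  by apply/setP=> a; rewrite in_code_of mem_imset //; apply: word_class_inj.
split=> [|x _ _ /imsetP[a Ca ->] /imsetP[b Cb ->]].
  by apply/imsetP; exists 0; rewrite ?word_class0.
have [c <-] := word_class_surj x.
rewrite /word_class.
elim/poly_ind: (word_poly c) a b Ca Cb => [|P r IH] a b Ca Cb.
  by rewrite rmorph0 mul0r add0r; apply/imsetP; exists b.
rewrite rmorphD rmorphM mulrDl -mulrA -addrA -!/(word_class _).
rewrite -word_class_constashift -word_class_linear.
by apply: IH; [apply: Cshift | apply: Cl].
Qed.

Lemma dual_anti C D : C \subset D -> dual D \subset dual C.
Proof.
move=> /subsetP sCD; apply/subsetP=> u; rewrite !inE => /forall_inP Du.
by apply/forall_inP=> c /sCD/Du.
Qed.

Lemma card_isodual C : isodual C -> #|dual C| = #|C|.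
Proof.
case=> sigma [d [Ud ->]]; rewrite card_imset // => a b /rowP eq_ab.
apply/rowP=> i; have := eq_ab ((sigma^-1)%g i).
by rewrite !mxE permKV; apply: mulrI; apply: Ud.
Qed.

(** Taking duals reverses inclusions and, on C, preserves cardinality, so C and
    D contain the same number of words. *)
Lemma isodual_comparable_self_dual C D :
  isodual C -> dual D = D -> C \subset D \/ D \subset C -> C = D.
Proof.
move=> /card_isodual cardC dualD [sCD | sDC].
  apply/eqP; rewrite eqEcard sCD -cardC -{1}dualD.
  by rewrite subset_leq_card ?dual_anti.
apply/esym/eqP; rewrite eqEcard sDC -cardC -[in leqRHS]dualD.
by rewrite subset_leq_card ?dual_anti.
Qed.

Lemma self_dual_isodual C : dual C = C -> isodual C.
Proof.
move=> dualC; exists 1%g, (fun=> 1); split=> [i|]; first exact: unitr1.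
rewrite dualC -[LHS]imset_id; apply: eq_imset => a.
by apply/rowP=> i; rewrite mxE perm1 mul1r.
Qed.

Lemma code_of_constant (g : R) a :
  (a \in code_of (principal (toA g%:P))) = [forall i, a 0 i \in principal g].
Proof.
rewrite in_code_of; apply/principalP/forallP => [[x]|ag].
  have [b <-] := word_class_surj x.
  rewrite mulrC -[_ * _]addr0 -word_class0 -word_class_linear addr0.
  move/word_class_inj=> -> i; apply/principalP; exists (b 0 i).
  by rewrite mxE mulrC.
have /fin_all_exists[b def_b] : forall i, exists y : R, a 0 i = y * g.
  by move=> i; apply/principalP.
exists (word_class (\row_i b i)).
rewrite mulrC -[RHS]addr0 -word_class0 -word_class_linear addr0.
congr word_class.
by apply/rowP=> i; rewrite !mxE def_b mulrC.
Qed.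

Lemma dual_code_of_constant (g : R) :
    (forall x, (g * x == 0) = (x \in principal g)) ->
  dual (code_of (principal (toA g%:P))) = code_of (principal (toA g%:P)).
Proof.
move=> ann_g; apply/setP=> u; rewrite code_of_constant inE.
apply/forall_inP/forallP => [dual_u i|gu c].
  (* testing u on the words with the single nonzero entry g *)
  have := dual_u (g *: delta_mx 0 i); rewrite code_of_constant => dual_ui.
  rewrite -ann_g mulrC; have := dual_ui _.
  rewrite (bigD1 i) //= big1 => [|j ne_ji].
    rewrite !mxE !eqxx mulr1 addr0; apply; apply/forallP=> j.
    by apply/principalP; exists ((delta_mx 0 i : 'rV[R]_N) 0 j);
      rewrite mxE mulrC.
  by rewrite !mxE (negPf ne_ji) andbF !mulr0.
rewrite code_of_constant => /forallP gc; apply/eqP/big1 => i _.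
have /principalP[x ->] := gc i.
have /eqP gu0 : g * u 0 i == 0 by rewrite ann_g.
by rewrite mulrC -mulrA gu0 mulr0.
Qed.

End Words.

(** * Units and separable binomials *)

Lemma teichmuller_unit {R : finComUnitRingType} {zeta a : R} {k} :
  k.-primitive_root zeta -> a \in teichmuller zeta k -> a != 0 ->
  a \is a GRing.unit.
Proof.
move=> zeta_prim; rewrite !inE => /orP[-> // | /imsetP[i _ ->] _].
rewrite unitrX //; apply/unitrPr; exists (zeta ^+ k.-1).
by rewrite -exprS prednK ?(prim_order_gt0 zeta_prim) ?prim_expr_order.
Qed.

Lemma separable_XnsubC (K : fieldType) (n : nat) (a : K) :
  n%:R != 0 :> K -> a != 0 -> separable_poly ('X^n - a%:P).
Proof.
move=> n_neq0 a_neq0; case: n n_neq0 => [|n n_neq0]; first by rewrite eqxx.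
rewrite unlock; apply/Bezout_eq1_coprimepP.
(* X f' - n f = n a is a nonzero constant *)
exists ((- a^-1)%:P, (a^-1 / n.+1%:R)%:P * 'X).
rewrite /= derivB derivC derivXn subr0 /= -scaler_nat -mul_polyC.
have -> : (a^-1 / n.+1%:R)%:P * 'X * (n.+1%:R%:P * 'X^n) = a^-1%:P * 'X^(n.+1).
  by rewrite mulrACA -polyCM divfK // exprS.
by rewrite polyCN mulNr mulrBr opprB subrK -polyCM mulVf.
Qed.

(** * The ring R[x]/(x^N - alpha - gamma beta) *)

Section Ambient.
Context {R : finComUnitRingType} {gamma : R}.
Hypothesis g2_eq0 : gamma ^+ 2 = 0.
Context {K : fieldType} (pi : {rmorphism R -> K}).
Hypothesis pi_surj : forall y, exists x, pi x = y.
Hypothesis pi_eq0 : forall x, (pi x == 0) = (x \in principal gamma).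
Context {p n s : nat} {alpha0 beta : R}.
Hypotheses (charKp : p \in [pchar K]) (n_gt0 : (0 < n)%N).
Hypothesis unit_beta : beta \is a GRing.unit.
Let N := (n * p ^ s)%N.
Let lam := alpha0 ^+ (p ^ s) + gamma * beta.
Let f : {poly R} := 'X^n - alpha0%:P.
Local Notation toA := (to_ambient N lam).

Let q_gt0 : (0 < p ^ s)%N.
Proof. by rewrite expn_gt0 prime_gt0 // (pcharf_prime charKp). Qed.

Let N_gt0 : (0 < N)%N.
Proof. by rewrite muln_gt0 n_gt0. Qed.

Let toA_gamma2 : toA gamma%:P ^+ 2 = 0.
Proof. by rewrite -rmorphXn -polyC_exp g2_eq0 polyC0 rmorph0. Qed.

(** The relation x^N = lam turns x^N - alpha into gamma beta. *)
Lemma binomial_class_pow_gamma :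
  exists H, toA f ^+ (p ^ s) = toA gamma%:P * (toA beta%:P + toA f * H).
Proof.
have [H def_fq] := pow_binomial pi pi_eq0 alpha0 p s n charKp n_gt0.
exists (toA H); rewrite -rmorphXn def_fq.
have -> : 'X^(n * p ^ s) - (alpha0 ^+ (p ^ s))%:P + gamma%:P * (f * H)
          = ('X^N - lam%:P) + gamma%:P * (beta%:P + f * H).
  by rewrite mulrDr addrA polyCD polyCM opprD addrA subrK.
rewrite rmorphD /= (to_ambient_modulus N_gt0) add0r rmorphM rmorphD /=.
by rewrite [toA (f * H)]rmorphM.
Qed.

Lemma binomial_class_nilpotent : toA f ^+ (p ^ s * 2) = 0.
Proof.
have [H def_Fq] := binomial_class_pow_gamma.
by rewrite exprM def_Fq exprMn toA_gamma2 mul0r.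
Qed.

(** Here beta + F H is the sum of a unit and a nilpotent. *)
Lemma binomial_class_pow_assoc :
  exists2 W, invertible W & toA f ^+ (p ^ s) = toA gamma%:P * W.
Proof.
have [H def_Fq] := binomial_class_pow_gamma.
exists (toA beta%:P + toA f * H) => //.
apply: (@invertibleD_nilpotent _ _ _ (p ^ s * 2)).
  by exists (toA beta^-1%:P); rewrite -rmorphM -polyCM divrr // rmorph1.
by rewrite exprMn binomial_class_nilpotent mul0r.
Qed.

Hypothesis irr : irreducible_poly (map_poly pi f).

(** Modulo F the ring is K[x]/(f), a field: gamma is itself a multiple of F.  A
    Bezout relation between b and f over K lifts to b u = 1 - z with z a
    multiple of F, hence nilpotent. *)
Lemma ambient_local (b : ambient N lam) :
  (exists c, b = c * toA f) \/ invertible b.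
Proof.
have [a <-] := word_class_surj N_gt0 b; rewrite /word_class.
move: (word_poly a) => P {a b}.
have [W [V VW1] def_Fq] := binomial_class_pow_assoc.
have [c def_G] : exists c, toA gamma%:P = c * toA f.
  exists (V * toA f ^+ (p ^ s).-1); rewrite -mulrA -exprSr prednK // def_Fq.
  by rewrite mulrCA (mulrC V) VW1 mulr1.
have [|copr] := boolP (map_poly pi f %| map_poly pi P).
  case/dvdpP=> q def_P; left; have [Q defQ] := map_poly_surj pi pi_surj q.
  have [|S def_S] := map_poly_ker pi pi_eq0 (P := P - Q * f).
    by rewrite rmorphB rmorphM /= defQ def_P subrr.
  exists (toA Q + toA S * c); rewrite -[P](subrK (Q * f)) def_S.
  by rewrite rmorphD !rmorphM /= def_G; ring.
right; have := irreducible_poly_coprime (map_poly pi P) irr.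
rewrite copr => /Bezout_eq1_coprimepP[[v u] /= eq1].
have [U defU] := map_poly_surj pi pi_surj u.
have [V1 defV] := map_poly_surj pi pi_surj v.
have [|S def_S] := map_poly_ker pi pi_eq0 (P := V1 * f + U * P - 1).
  by rewrite rmorphB rmorphD !rmorphM rmorph1 /= defU defV eq1 subrr.
pose z := toA f * (toA V1 - c * toA S).
have [|y] := @invertible_1B_nilpotent _ z (p ^ s * 2).
  by rewrite /z exprMn binomial_class_nilpotent mul0r.
have -> : 1 - z = toA P * toA U.
  have : toA (V1 * f + U * P - 1) = toA (gamma%:P * S) by rewrite def_S.
  rewrite rmorphB rmorphD !rmorphM rmorph1 /= def_G => eqA.
  have -> : toA P * toA U
      = (toA V1 * toA f + toA U * toA P - 1) + 1 - toA V1 * toA f by ring.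
  by rewrite eqA /z; ring.
by rewrite -mulrA; exists (toA U * y).
Qed.

End Ambient.

(** * The isodual code *)

Theorem corollary3p1
  (R : finComUnitRingType) (gamma zeta alpha alpha0 beta : R) (p m n s : nat)
  (chainR : is_chain_ring R)
  (maxg : is_maximal_ideal (principal gamma))
  (g_neq0 : gamma != 0) (g2_eq0 : gamma ^+ 2 = 0)
  (pr_p : prime p)
  (residue_card : #|cosets (principal gamma)| = (p ^ m)%N)
  (ord_zeta : (p ^ m - 1)%N.-primitive_root zeta)
  (n_gt0 : (0 < n)%N) (s_gt0 : (0 < s)%N) (co_np : coprime n p)
  (Ta0 : alpha0 \in teichmuller zeta (p ^ m - 1))
  (def_alpha : alpha = alpha0 ^+ (p ^ s))
  (Ta : alpha \in teichmuller zeta (p ^ m - 1) :\ 0)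
  (irr : irreducible_elt ('X^n - alpha0%:P : {poly R}))
  (Tb : beta \in teichmuller zeta (p ^ m - 1) :\ 0) :
  let N := (n * p ^ s)%N in
  let lam := alpha + gamma * beta in
  let I := principal (to_ambient N lam (('X^n - alpha0%:P) ^+ (p ^ s))) in
  [/\ I = principal (to_ambient N lam gamma%:P),
      constacyclic lam (code_of I),
      isodual (code_of I) &
      forall C : {set 'rV[R]_N}, constacyclic lam C -> isodual C -> C = code_of I].
Proof.
have [K [pi [pi_surj pi_eq0]]] := exists_residue_field maxg g2_eq0.
have charKp : p \in [pchar K].
  rewrite inE pr_p; have := card_residue_eq0 pi pi_surj pi_eq0.
  by rewrite residue_card natrX => /eqP; rewrite expf_eq0 => /andP[].
have [/setD1P[a_neq0 _] /setD1P[b_neq0 Tb1]] := (Ta, Tb).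
have q_gt0 : (0 < p ^ s)%N by rewrite expn_gt0 prime_gt0.
have unit_a0 : alpha0 \is a GRing.unit.
  apply: (teichmuller_unit ord_zeta Ta0).
  by apply: contra_neq a_neq0 => a0; rewrite def_alpha a0 expr0n gtn_eqF.
have unit_b := teichmuller_unit ord_zeta Tb1 b_neq0.
have irrK : irreducible_poly (map_poly pi ('X^n - alpha0%:P)).
  apply: irreducible_reduction pi_surj pi_eq0 _ g2_eq0 _ _ irr.
    exact: monicXnsubC.
  rewrite rmorphB /= map_polyXn map_polyC /=; apply: separable_XnsubC.
    by rewrite -(dvdn_pcharf charKp) -prime_coprime // coprime_sym.
  by rewrite -unitfE rmorph_unit.
subst alpha => N lam I.
have N_gt0 : (0 < N)%N by rewrite muln_gt0 n_gt0.
have [W unitW def_Fq] := binomial_class_pow_assoc g2_eq0 pi pi_eq0 charKp n_gt0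
  unit_b (s := s) (alpha0 := alpha0).
have def_I : I = principal (to_ambient N lam gamma%:P).
  by rewrite /I rmorphXn /= def_Fq principal_assoc.
have idI : is_ideal I by apply: principal_is_ideal.
have dualI : dual (code_of I) = code_of I.
  by rewrite def_I dual_code_of_constant // => x; apply: annihilator_maximal.
split=> // [||C constC isoC].
- exact: code_of_constacyclic.
- exact: self_dual_isodual.
apply: isodual_comparable_self_dual isoC dualI _ => //.
have [J idJ ->] := constacyclic_code_of N_gt0 constC.
have loc := ambient_local g2_eq0 pi pi_surj pi_eq0 charKp n_gt0 unit_b irrK
  (s := s).
have sub (J1 J2 : {set ambient N lam}) :
  J1 \subset J2 -> code_of J1 \subset code_of J2.
  by move=> /subsetP sJ; apply/subsetP=> a; rewrite !inE; apply: sJ.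
have [] := ideal_comparable loc (p ^ s) J idJ; rewrite -rmorphXn => /sub;
  by [left | right].
Qed.
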